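(* For $n\ge 0$, the coefficient $c(B^{(2)};n)$ is odd if and only if $n=2k^2+2k$ for some integer $k\ge 0$. Moreover, for every integer $N\ge 0$, $$\#\{0\le n\le N:\ c(B^{(2)};n)\equiv 1 \pmod 2\}=\left\lfloor\frac{\sqrt{2N+1}+1}{2}\right\rfloor.$$
   Context: $(a;q)_n=\prod_{k=0}^{n-1}(1-aq^k)$. For a formal power series $g(q)=\sum_{n\ge0}c(n)q^n$, $c(g;n):=c(n)$. $\lfloor x\rfloor$ is the integer part of $x$. The second order mock theta function is $$B^{(2)}(q)=\sum_{n=0}^{\infty}\frac{q^{n}(-q;q^2)_n}{(q;q^2)_{n+1}}.$$ *)

(* Defs.v *)
From mathcomp Require Import all_boot all_order all_algebra.
From mathcomp Require Import reals zify.

Set Implicit Arguments.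
Unset Strict Implicit.
Unset Printing Implicit Defensive.

Import Order.TTheory GRing.Theory Num.Theory.
Local Open Scope ring_scope.

(* (a; q)_n *)
Definition qpoch (R : comPzRingType) (a q : R) (n : nat) : R :=
  \prod_(k < n) (1 - a * q ^+ k).

(* A formal power series over the integers is its sequence of coefficients. *)
Definition fps : Type := nat -> int.

Definition fps_coef (g : fps) (n : nat) : int := g n.

(* The power series p / d, for polynomials p and d with d`_0 = 1: the inverse
   of d is the geometric series of 1 - d, and as 'X divides 1 - d only the
   powers j <= n contribute to the coefficient of 'X^n.  See [fps_divP]. *)
Definition fps_div (p d : {poly int}) : fps :=
  fun n => (p * \sum_(j < n.+1) (1 - d) ^+ j)`_n.

(* q^n (-q; q^2)_n / (q; q^2)_(n+1), with the indeterminate 'X for q *)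
Definition B2_term (n : nat) : fps :=
  fps_div ('X^n * qpoch (- 'X) 'X^2 n) (qpoch 'X 'X^2 n.+1).

(* The sum over all m of B2_term m: since B2_term m is divisible by q^m, the
   coefficient of q^n only receives the terms m <= n.  See [B2_sum]. *)
Definition B2 : fps := fun n => \sum_(m < n.+1) fps_coef (B2_term m) n.

Lemma coef_exp_lt (e : {poly int}) (j n : nat) :
  e`_0 = 0 -> (n < j)%N -> (e ^+ j)`_n = 0.
Proof.
move=> e0; elim: j n => // j IHj n ltnj.
rewrite exprS coefM big1 // => -[[|i] /= ltin] _; first by rewrite e0 mul0r.
by rewrite IHj ?mulr0 //; lia.
Qed.

Lemma fps_div_trunc (p d : {poly int}) (n M : nat) :
  d`_0 = 1 -> (n < M)%N ->
  (p * \sum_(j < M) (1 - d) ^+ j)`_n = fps_div p d n.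
Proof.
move=> d0 ltnM; rewrite /fps_div !coefM; apply: eq_bigr => i _; congr (_ * _).
rewrite -(subnKC ltnM) big_split_ord /= coefD [X in _ + X]coef_sum.
rewrite [X in _ + X]big1 ?addr0 // => j _.
by apply: coef_exp_lt; [rewrite coefB coef1 d0 subrr | lia].
Qed.

Lemma fps_divP (p d : {poly int}) :
  d`_0 = 1 ->
  forall n, \sum_(i < n.+1) d`_i * fps_coef (fps_div p d) (n - i) = p`_n.
Proof.
move=> d0 n; set S := \sum_(j < n.+1) (1 - d) ^+ j.
transitivity ((d * (p * S))`_n).
  rewrite coefM; apply: eq_bigr => i _; congr (_ * _).
  by rewrite /fps_coef -(@fps_div_trunc p d (n - i) n.+1) ?ltnS ?leq_subr.
have dS : d * S = 1 - (1 - d) ^+ n.+1.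
  by rewrite -[RHS]opprB subrX1 -mulNr opprB subKr.
rewrite mulrCA dS mulrBr mulr1 coefB [X in _ - X]coefM.
rewrite [X in _ - X]big1 ?subr0 // => i _.
by rewrite coef_exp_lt ?mulr0 ?coefB ?coef1 ?d0 ?subrr //; lia.
Qed.

Lemma qpochX0 (n : nat) : (qpoch 'X 'X^2 n : {poly int})`_0 = 1.
Proof.
rewrite /qpoch -horner_coef0 horner_prod big1 // => i _.
by rewrite hornerD hornerN hornerM hornerX mul0r subr0 hornerC.
Qed.

Lemma B2_term_lt (m n : nat) : (n < m)%N -> fps_coef (B2_term m) n = 0.
Proof.
by move=> ltnm; rewrite /fps_coef /B2_term /fps_div -mulrA coefXnM ltnm.
Qed.

Lemma B2_sum (n M : nat) :
  (n < M)%N -> \sum_(m < M) fps_coef (B2_term m) n = fps_coef B2 n.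
Proof.
move=> ltnM; rewrite -(subnKC ltnM) big_split_ord /=.
rewrite [X in _ + X]big1 ?addr0 // => j _.
by apply: B2_term_lt; rewrite /=; lia.
Qed.

(* Main.v *)
Require Import Defs.
From mathcomp Require Import all_boot all_order all_algebra.
From mathcomp Require Import reals.
From mathcomp Require Import zify ring lra.

Import Order.TTheory GRing.Theory Num.Theory.
Local Open Scope ring_scope.

(** Modulo 2 the signs in (-q; q^2)_m disappear, so this product cancels all
    factors of (q; q^2)_(m+1) but the last one, 1 - q^(2m+1).  Hence, modulo 2,
    the series is
      \sum_m q^m / (1 - q^(2m+1)) = \sum_(m, j) q^(m + j (2m+1)),
    and its n-th coefficient counts the pairs (m, j) with n = m + j + 2mj
    ([B2_mod2]), that is 2n+1 = (2m+1)(2j+1).  Exchanging m and j pairs off the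
    solutions with m != j, so the parity is decided by the diagonal solutions
    n = 2k^2 + 2k ([odd_sum_symmetric]), of which there is at most one.

    For the count, the number K of such n up to N is characterized by
    2K(K-1) <= N < 2K(K+1) ([count_diag_bounds]), which says
    (2K-1)^2 <= 2N+1 < (2K+1)^2; taking square roots gives the floor. *)

Lemma fps_divB (p p' d : {poly int}) n :
  fps_div (p - p') d n = fps_div p d n - fps_div p' d n.
Proof. by rewrite /fps_div mulrBl coefB. Qed.

Lemma fps_divMn (p d : {poly int}) k n :
  fps_div (p *+ k) d n = fps_div p d n *+ k.
Proof. by rewrite /fps_div mulrnAl coefMn. Qed.

(** Factor by factor: 1 + a q^k = (1 - a q^k) + 2 a q^k. *)
Lemma qpochN_mod2 (R : comPzRingType) (a q : R) n :
  exists h, qpoch (- a) q n = qpoch a q n + h *+ 2.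
Proof.
elim: n => [|n [h IHn]]; first by exists 0; rewrite /qpoch !big_ord0; ring.
exists (qpoch a q n * (a * q ^+ n) + h * (1 + a * q ^+ n)).
move: IHn; rewrite /qpoch !big_ord_recr /= => ->; ring.
Qed.

(** The quotient is u / (1 - 'X^r), a geometric series with partial sum G.  The
    truncated inverse S of the denominator d satisfies
    d S = 1 - (1 - d)^(n+1), so that
      u e S (1 - 'X^(r (n+1))) = u e S (1 - 'X^r) G = u G - u G (1 - d)^(n+1),
    and both error terms only have powers of 'X greater than n. *)
Lemma fps_div_cancel (u e : {poly int}) r n :
  (0 < r)%N -> e`_0 = 1 ->
  fps_div (u * e) (e * (1 - 'X^r)) n = (u * \sum_(j < n.+1) 'X^(r * j))`_n.
Proof.
move=> r_gt0 e0; rewrite /fps_div.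
set d := e * _; set S := \sum_(j < _) (1 - d) ^+ j; set G := \sum_(j < _) _.
have dS : d * S = 1 - (1 - d) ^+ n.+1.
  by rewrite -[RHS]opprB subrX1 -mulNr opprB subKr.
have rG : (1 - 'X^r) * G = 1 - 'X^(r * n.+1).
  rewrite -[RHS]opprB exprM subrX1 -mulNr opprB; congr (_ * _).
  by apply: eq_bigr => j _; rewrite exprM.
have d0 : (1 - d)`_0 = 0.
  rewrite coefB coef1 /d coef0M e0 coefB coef1 coefXn.
  by case: r r_gt0 {d S G dS rG}.
have key : u * e * S = u * G - u * G * (1 - d) ^+ n.+1
                       + u * e * S * 'X^(r * n.+1).
  have -> : u * G - u * G * (1 - d) ^+ n.+1 = u * G * (d * S).
    by rewrite dS; ring.
  have -> : u * G * (d * S) = u * e * S * ((1 - 'X^r) * G) by rewrite /d; ring.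
  rewrite rG; ring.
rewrite key coefD coefB coefMXn; have -> : (n < r * n.+1)%N by nia.
rewrite [X in _ - X]coefM big1 ?subr0 ?addr0 // => i _.
by rewrite coef_exp_lt ?mulr0 //; lia.
Qed.

Lemma B2_term_mod2 m n :
  (2 %| fps_coef (B2_term m) n
        - (\sum_(j < n.+1) (n == m + (2 * m + 1) * j))%N%:Z)%Z.
Proof.
have [h hE] := @qpochN_mod2 {poly int} 'X ('X^2) m.
have -> : (\sum_(j < n.+1) (n == m + (2 * m + 1) * j))%N%:Z =
  fps_div ('X^m * qpoch 'X 'X^2 m) (qpoch 'X 'X^2 m.+1) n.
  have -> : qpoch 'X 'X^2 m.+1
            = qpoch 'X 'X^2 m * (1 - 'X^(2 * m + 1)) :> {poly int}.
    by rewrite {1}/qpoch big_ord_recr /= -exprM -exprS addn1.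
  rewrite fps_div_cancel ?qpochX0 ?addn1 // mulr_sumr coef_sum -natz raddf_sum.
  by apply: eq_bigr => j _; rewrite -exprD coefXn.
rewrite /fps_coef /B2_term -fps_divB hE mulrDr addrC addKr.
by rewrite mulrnAr fps_divMn -[X in (_ %| X)%Z]mulr_natr dvdz_mull.
Qed.

Lemma B2_mod2 n :
  (2 %| fps_coef B2 n
    - (\sum_(m < n.+1) \sum_(j < n.+1) (n == m + (2 * m + 1) * j))%N%:Z)%Z.
Proof.
rewrite -[X in _ - X]natz raddf_sum /fps_coef /B2 -sumrB.
by apply: rpred_sum => m _; have := B2_term_mod2 m n; rewrite -[X in _ - X]natz.
Qed.

(** Off-diagonal terms cancel in pairs. *)
Lemma odd_sum_symmetric (F : nat -> nat -> nat) n :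
  (forall i j, F i j = F j i) ->
  odd (\sum_(i < n) \sum_(j < n) F i j) = odd (\sum_(i < n) F i i).
Proof.
move=> F_sym; elim: n => [|n IHn]; first by rewrite !big_ord0.
rewrite !big_ord_recr /=.
under eq_bigr => i _ do rewrite big_ord_recr /=.
rewrite big_split /= !oddD IHn.
have -> : (\sum_(i < n) F n i = \sum_(i < n) F i n)%N by apply: eq_bigr.
by rewrite -addbA [X in _ (+) X]addbA addbb.
Qed.

Lemma diag_inj : injective (fun k => 2 * k ^ 2 + 2 * k)%N.
Proof. by move=> i j /=; nia. Qed.

Definition is_diag n := [exists k : 'I_n.+1, n == 2 * k ^ 2 + 2 * k]%N.

Lemma is_diagP n :
  reflect (exists k, n = 2 * k ^ 2 + 2 * k)%N (is_diag n).
Proof.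
apply: (iffP existsP) => [[k /eqP nE]|[k nE]]; first by exists (k : nat).
have lt_kn : (k < n.+1)%N by rewrite ltnS nE; nia.
by exists (Ordinal lt_kn); apply/eqP.
Qed.

Lemma B2_odd n : ~~ (2 %| fps_coef B2 n)%Z = is_diag n.
Proof.
set S := (\sum_(m < n.+1) \sum_(j < n.+1) (n == m + (2 * m + 1) * j))%N.
have -> : (2 %| fps_coef B2 n)%Z = (2 %| S%:Z)%Z.
  by rewrite -(subrK S%:Z (fps_coef B2 n)) rpredDl // B2_mod2.
rewrite dvdzE /= dvdn2 negbK.
rewrite (@odd_sum_symmetric (fun m j => n == m + (2 * m + 1) * j)%N);
  last by move=> i j; congr (nat_of_bool (n == _)); ring.
have diagE (k : nat) : (k + (2 * k + 1) * k = 2 * k ^ 2 + 2 * k)%N by ring.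
under eq_bigr => k _ do rewrite diagE.
case: (boolP (is_diag n)) => [/existsP[k nE]|noK]; last first.
  rewrite big1 // => k _; apply/eqP; rewrite eqb0.
  by apply: contra noK => /eqP nE; apply/is_diagP; exists k.
rewrite (bigD1 k) //= nE big1 // => i i_k; apply/eqP; rewrite eqb0.
apply: contra i_k => /eqP; rewrite {1}(eqP nE) => /diag_inj ki.
by apply/eqP/val_inj.
Qed.

(** While N grows, K increases exactly when N meets the upper bound, which is
    the next number of the form 2k^2 + 2k. *)
Lemma count_diag_bounds N :
  let K := (\sum_(n < N.+1) is_diag n)%N in
  [/\ 0 < K, 2 * K ^ 2 <= N + 2 * K & N < 2 * K ^ 2 + 2 * K]%N.
Proof.
elim: N => [|N IHN] /=.
  by rewrite big_ord1; have -> : is_diag 0 by apply/is_diagP; exists 0%N.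
rewrite big_ord_recr /=; move: IHN.
move: (\sum_(n < N.+1) is_diag n)%N => K [K_gt0 leN ltN].
case: (is_diagP N.+1) => [[k NE]|noK].
  have <- : k = K by nia.
  by split; nia.
have : N.+1 != (2 * K ^ 2 + 2 * K)%N by apply/eqP => NE; apply: noK; exists K.
by rewrite addn0; split; lia.
Qed.

Theorem theorem3p2 (R : realType) :
  (forall n : nat,
     ~~ (2 %| fps_coef B2 n)%Z <->
     exists k : nat, n = (2 * k ^ 2 + 2 * k)%N) /\
  (forall N : nat,
     #|[set n : 'I_N.+1 | (fps_coef B2 n == 1 %[mod 2])%Z]|%:Z =
     Num.floor ((Num.sqrt (2 * N%:R + 1) + 1) / 2 : R)).
Proof.
split=> [n|N]; first by rewrite B2_odd; split=> /is_diagP.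
have odd_mod2 (z : int) : (z == 1 %[mod 2])%Z = ~~ (2 %| z)%Z by lia.
have -> : #|[set n : 'I_N.+1 | (fps_coef B2 n == 1 %[mod 2])%Z]|
          = (\sum_(n < N.+1) is_diag n)%N.
  rewrite -sum1_card big_mkcond /=; apply: eq_bigr => n _.
  by rewrite inE odd_mod2 B2_odd; case: is_diag.
have [] := count_diag_bounds N.
move: (\sum_(n < N.+1) is_diag n)%N => K K_gt0 leN ltN.
apply/esym/floor_def; rewrite intrD -pmulrn.
have K_ge1 : 1 <= K%:R :> R by rewrite ler1n.
have N_ge0 : 0 <= N%:R :> R by [].
have sqr_le : (2 * K%:R - 1) ^+ 2 <= 2 * N%:R + 1 :> R.
  by move: leN; rewrite -(ler_nat R) !natrD !natrM; lra.
have sqr_gt : 2 * N%:R + 1 < (2 * K%:R + 1) ^+ 2 :> R.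
  by move: ltN; rewrite -(ltr_nat R) !natrD !natrM; lra.
have lo : 2 * K%:R - 1 <= Num.sqrt (2 * N%:R + 1) :> R.
  by rewrite -[leLHS]ger0_norm -?sqrtr_sqr ?ler_sqrt //; lra.
have hi : Num.sqrt (2 * N%:R + 1) < 2 * K%:R + 1 :> R.
  by rewrite -[ltRHS]ger0_norm -?sqrtr_sqr ?ltr_sqrt //; lra.
by apply/andP; split; lra.
Qed.
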